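(* For every $b\in(1,2]$ there exists a positive constant $B=B(b)$, depending only on $b$, such that for any compact sets $\Omega^1,\Omega^2$ (compact subsets of Euclidean spaces), any continuous function $K(\mathbf x,\mathbf y)$ on $\Omega^1\times\Omega^2$, and every $m\in\mathbb N$, $$ \sigma_m(K,\mathcal{LK}(\infty))_\infty \le B\, m^{1/2}\, \sigma_{\theta(m-1)}(K,\Pi(\infty))_\infty , $$ with $\theta=1/b$ in the real case (all functions and coefficients real-valued) and $\theta=1/(2b)$ in the complex case (all functions and coefficients complex-valued).
   Context: $\|\cdot\|_\infty$ denotes the uniform (supremum) norm, and $L_\infty(\Omega)$ is understood as the space of continuous functions on $\Omega$ with this norm. For a system $\mathcal D$ of functions on $\Omega^1\times\Omega^2$, $\sigma_m(K,\mathcal D)_\infty := \inf \|K-\sum_{i=1}^m c_i g_i\|_\infty$, where the infimum is over scalars $c_i$ and elements $g_i\in\mathcal D$ ($\sigma_0(K,\mathcal D)_\infty=\|K\|_\infty$). For real $s\ge 0$, $\sigma_s$ means $\sigma_{\lfloor s\rfloor}$. Bilinear dictionary: $\Pi(\infty)$ is the set of all functions $u(\mathbf x)v(\mathbf y)$ with $u\in L_\infty(\Omega^1)$, $v\in L_\infty(\Omega^2)$. Adaptive system determined by $K$: $\mathcal{LK}(\infty)$ is the set of all functions of the form $u(\mathbf x)K(\mathbf z,\mathbf y)$ with $\mathbf z\in\Omega^1$ and $u\in L_\infty(\Omega^1)$ ($u$ may depend on $\mathbf z$). Thus $\sigma_m(K,\mathcal{LK}(\infty))_\infty=\inf_{\xi^j,u_j}\sup_{\mathbf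 x,\mathbf y}|K(\mathbf x,\mathbf y)-\sum_{j=1}^m u_j(\mathbf x)K(\xi^j,\mathbf y)|$. *)

(* Defs.v *)
From HB Require Import structures.
From mathcomp Require Import all_boot all_order all_algebra.
From mathcomp Require Import complex.
From mathcomp Require Import all_classical all_reals all_analysis.

Set Implicit Arguments.
Unset Strict Implicit.
Unset Printing Implicit Defensive.

Import Order.TTheory GRing.Theory Num.Theory.
Import numFieldNormedType.Exports.

Local Open Scope classical_set_scope.
Local Open Scope ring_scope.

(* A function on a set A is represented by a total function on the ambient
   space, of which only the values on A matter: continuity is that of the
   restriction to A, and the norm is the supremum over A.
   The scalar field F is R or R[i].  Since the norm `|z| of a complex number
   lives in R[i], the R-valued modulus is passed as the parameter "abs". *)

Section Approximation.
Variables (R : realType) (F : numFieldType) (abs : F -> R).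

Definition unif_norm (T : Type) (A : set T) (f : T -> F) : R :=
  sup [set abs (f t) | t in A].

Definition best_approx (T : Type) (A : set T) (D : set (T -> F)) (m : nat)
    (f : T -> F) : R :=
  inf [set e : R | exists (c : 'I_m -> F) (g : 'I_m -> T -> F),
    (forall i, D (g i)) /\
    e = unif_norm A (fun t => f t - \sum_(i < m) c i * g i t)].

(* For s >= 0, Num.truncn s is the natural number floor of s. *)
Definition best_approx_real (T : Type) (A : set T) (D : set (T -> F)) (s : R)
    (f : T -> F) : R :=
  best_approx A D (Num.truncn s) f.

End Approximation.

Section Dictionaries.
Variables (F : numFieldType) (X Y : topologicalType).

Definition bilinear_dict (Omega1 : set X) (Omega2 : set Y) :
    set (X * Y -> F) :=
  [set g | exists (u : X -> F) (v : Y -> F),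
    [/\ {within Omega1, continuous u}, {within Omega2, continuous v}
      & g = (fun p => u p.1 * v p.2)]].

Definition adaptive_dict (Omega1 : set X) (K : X * Y -> F) :
    set (X * Y -> F) :=
  [set g | exists (z : X) (u : X -> F),
    [/\ Omega1 z, {within Omega1, continuous u}
      & g = (fun p => u p.1 * K (z, p.2))]].

End Dictionaries.

Definition abs_real (R : realType) (x : R) : R := `|x|.

(* R[i] alone has no declared topology; seen as a numFieldType it gets the one
   induced by the modulus. *)
Definition complex_numField (R : realType) : numFieldType :=
  Num.NumField.clone R[i] _.

Definition abs_complex (R : realType) (z : complex_numField R) : R := complex.Re `|z|.

(* Main.v *)
Require Import Defs.
From HB Require Import structures.
From mathcomp Require Import all_boot all_order all_algebra.
From mathcomp Require Import all_classical all_reals all_analysis.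
From mathcomp Require Import complex ring lra.

(** Fix a bilinear approximant of [K], with factors [u_i(x)] and [v_i(y)],
    [i < n], and uniform error [e].  It suffices to build, for the span of the
    [u_i], a sampling operator [f |-> \sum_j U_j(x) f(xi_j)] on [m] nodes that
    almost reproduces the [u_i] and satisfies [\sum_j |U_j(x)| <= s * sqrt m]
    with [s = (b - 1)^(-1/2)].  Applied to each section [K(., y)] it gives an
    element of the adaptive system whose error is at most
    [(1 + s * sqrt m) * e <= (1 + s) * sqrt m * e], up to an arbitrarily small
    term, so that [B = 1 + s] is suitable ([sampling_error]).

    The nodes come from a maximal volume argument.  Let [phi(x)] be the row
    vector of [N] real functions and, for nodes [xi_1, ..., xi_m], let
    [G = lam I + \sum_j phi(xi_j)^T phi(xi_j)].  Choose nodes almost maximizing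
    [\det G].  For a point [x], put [H = G + phi(x)^T phi(x)].  By the rank one
    update formula for determinants, removing one of the [m + 1] points
    [xi_1, ..., xi_m, x] multiplies [\det H] by one minus the leverage
    [phi(z) H^-1 phi(z)^T] of the removed point [z].  Removing [x] is almost
    optimal, so [1 - h(xi_i)] is at most [(m + 1) / m] times [1 - h(x)], where
    [h] is the leverage.  As the [m + 1] leverages sum to at most [N], this gives
    [phi(x) G^-1 phi(x)^T <= (N + 1) / (m + 1 - N) <= 1 / (b - 1)]
    ([near_max_leverage_le]).  The weights
    [U_j(x) = phi(x) G^-1 phi(xi_j)^T] satisfy
    [\sum_j U_j(x)^2 <= phi(x) G^-1 phi(x)^T], and the Cauchy-Schwarz
    inequality bounds [\sum_j |U_j(x)|].  The regularization by [lam > 0] makes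
    [G] invertible without any independence assumption; it spoils the
    reproduction of [phi] only by a term that vanishes with [lam]
    ([sampling_operator]).

    Real and complex scalars are treated together: over a field of real
    dimension [d], the real coordinates of the [u_i] form a family of
    [N = n * d] real functions, and real weights suffice.  This is where the
    factor 2 of the complex case comes from. *)

Import Order.TTheory GRing.Theory Num.Theory.
Import numFieldNormedType.Exports.

Set Implicit Arguments.
Unset Strict Implicit.
Unset Printing Implicit Defensive.

Local Open Scope classical_set_scope.
Local Open Scope ring_scope.

(** * Coercive quadratic forms and rank one updates *)

(** Both sides are the determinant of the block matrix with rows [(1, - c)] and
    [(r, 1)]. *)
Lemma det_1D_col_row (R : comUnitRingType) n (c : 'cV[R]_n) (r : 'rV[R]_n) :
  \det (1%:M + c *m r) = 1 + (r *m c) 0 0.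
Proof.
have E : block_mx 1%:M 0 r 1%:M *m block_mx 1%:M (- c) 0 (1%:M + r *m c) =
         block_mx (1%:M + c *m r) (- c) 0 1%:M *m block_mx 1%:M 0 r 1%:M.
  rewrite !mulmx_block !mul1mx !mulmx1 !mulmx0 !mul0mx !addr0 !add0r.
  by rewrite mulNmx addrK mulmxN addrC addrK.
move/(congr1 determinant): E.
rewrite !det_mulmx !det_lblock !det_ublock !det1 !mul1r !mulr1 => <-.
by rewrite det_mx11 !mxE eqxx.
Qed.

Section QuadraticForms.
Variables (R : realFieldType) (N : nat).
Implicit Types (A : 'M[R]_N) (x v : 'rV[R]_N).

(** The quadratic form [x A x^T] on row vectors. *)
Definition qform A x : R := (x *m A *m x^T) 0 0.

Lemma det_rank1D A v : A \in unitmx ->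
  \det (A + v^T *m v) = \det A * (1 + qform (invmx A) v).
Proof.
move=> uA.
have -> : A + v^T *m v = A *m (1%:M + (invmx A *m v^T) *m v).
  by rewrite mulmxDr mulmx1 !mulmxA mulmxV // mul1mx.
by rewrite det_mulmx det_1D_col_row /qform !mulmxA.
Qed.

Lemma det_rank1B A v : A \in unitmx ->
  \det (A - v^T *m v) = \det A * (1 - qform (invmx A) v).
Proof.
move=> uA.
have -> : A - v^T *m v = A *m (1%:M + (invmx A *m v^T) *m (- v)).
  by rewrite mulmxDr mulmx1 !mulmxA mulmxV // mul1mx mulmxN.
by rewrite det_mulmx det_1D_col_row /qform !mulNmx mulmxA [X in 1 + X]mxE.
Qed.

Lemma qform1E v : qform 1%:M v = \sum_i v 0 i ^+ 2.
Proof.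
rewrite /qform mulmx1 mxE; apply: eq_bigr => i _.
by rewrite mxE expr2.
Qed.

(** [A] is symmetric and bounded below by [lam] times the identity; [lam] is
    kept explicit because it quantifies the bounds on the inverse. *)
Definition coercive (lam : R) A :=
  A^T = A /\ forall x, lam * qform 1%:M x <= qform A x.

Variables (lam : R) (A : 'M[R]_N).
Hypotheses (lam_gt0 : 0 < lam) (coA : coercive lam A).

Lemma qform1_ge0 v : 0 <= qform 1%:M v.
Proof. by rewrite qform1E sumr_ge0 // => i _; rewrite sqr_ge0. Qed.

Lemma coercive_unitmx : A \in unitmx.
Proof.
rewrite -row_free_unit; apply: inj_row_free => x xA0.
have := coA.2 x.
rewrite /qform xA0 mul0mx [X in _ <= X]mxE -/(qform _ _) => le0.
have /eqP : qform 1%:M x = 0.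
  by apply/eqP; rewrite eq_le qform1_ge0 andbT -(pmulr_rle0 _ lam_gt0).
rewrite qform1E psumr_eq0 => [/allP z|i _]; last exact: sqr_ge0.
apply/rowP => i; rewrite mxE; apply/eqP.
by move: (z i (mem_index_enum _)); rewrite sqrf_eq0.
Qed.

Lemma qform_invmx x : qform (invmx A) x = qform A (x *m invmx A).
Proof.
rewrite /qform trmx_mul trmx_inv coA.1 -!mulmxA; congr ((x *m _) 0 0).
by rewrite [in RHS]mulmxA mulVmx ?mul1mx // coercive_unitmx.
Qed.

Lemma qform_coercive_ge0 x : 0 <= qform A x.
Proof. by apply: le_trans (coA.2 x); rewrite mulr_ge0 ?qform1_ge0 // ltW. Qed.

Lemma qform_invmx_ge0 x : 0 <= qform (invmx A) x.
Proof. by rewrite qform_invmx qform_coercive_ge0. Qed.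

Lemma mxtrace_invmx_ge0 : 0 <= \tr (invmx A).
Proof.
rewrite sumr_ge0 // => i _.
have := qform_invmx_ge0 (delta_mx 0 i).
by rewrite /qform -rowE trmx_delta -colE !mxE.
Qed.

(** As long as [x A^-1 x^T] stays bounded, the entries of [lam x A^-1] are
    [O(sqrt lam)]: this is what makes the regularization harmless. *)
Lemma mulmx_invmx_le x i :
  (lam * (x *m invmx A) 0 i) ^+ 2 <= lam * qform (invmx A) x.
Proof.
rewrite exprMn expr2 -mulrA ler_pM2l // qform_invmx.
apply: le_trans (coA.2 _); rewrite ler_pM2l // qform1E (bigD1 i) //= lerDl.
by rewrite sumr_ge0 // => j _; rewrite sqr_ge0.
Qed.

Lemma qform_invmx_le x : qform (invmx A) x <= qform 1%:M x / lam.
Proof.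
set w := x *m invmx A.
have wx : qform (invmx A) x = \sum_i w 0 i * x 0 i.
  by rewrite /qform mxE; apply: eq_bigr => i _; rewrite [x^T _ _]mxE.
suff : 2 * qform (invmx A) x <= lam * qform 1%:M w + qform 1%:M x / lam.
  move: (coA.2 w); rewrite -qform_invmx; lra.
rewrite wx !qform1E mulr_suml !mulr_sumr -big_split /=.
apply: ler_sum => i _; rewrite -subr_ge0.
suff -> : lam * w 0 i ^+ 2 + x 0 i ^+ 2 / lam - 2 * (w 0 i * x 0 i) =
    (lam * w 0 i - x 0 i) ^+ 2 / lam by rewrite divr_ge0 ?sqr_ge0 // ltW.
by field; rewrite gt_eqF.
Qed.

End QuadraticForms.

(** * Regularized Gram matrices and near-maximal determinants *)

Section Gram.
Variables (R : realFieldType) (N : nat) (lam : R).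
Hypothesis lam_gt0 : 0 < lam.

(** The sum of the [p_j^T p_j], regularized by [lam] times the identity. *)
Definition gram m (p : 'I_m -> 'rV[R]_N) : 'M[R]_N :=
  lam%:M + \sum_j (p j)^T *m p j.

Lemma qform_gram m (p : 'I_m -> 'rV[R]_N) x :
  qform (gram p) x = lam * qform 1%:M x + \sum_j (x *m (p j)^T) 0 0 ^+ 2.
Proof.
rewrite /qform /gram mulmxDr mulmxDl [LHS]mxE mulmx1 mul_mx_scalar -scalemxAl.
rewrite [X in X + _]mxE; congr (_ + _).
rewrite mulmx_sumr mulmx_suml summxE; apply: eq_bigr => j _.
rewrite mulmxA -mulmxA [LHS]mxE big_ord1 expr2; congr (_ * _).
by rewrite -[x in X in _ = X]trmxK -trmx_mul [RHS]mxE.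
Qed.

Lemma gram_coercive m (p : 'I_m -> 'rV[R]_N) : coercive lam (gram p).
Proof.
split=> [|x].
  rewrite /gram linearD /= tr_scalar_mx linear_sum /=; congr (_ + _).
  by apply: eq_bigr => j _; rewrite trmx_mul trmxK.
by rewrite qform_gram lerDl sumr_ge0 // => j _; rewrite sqr_ge0.
Qed.

Lemma gram_recr m (p : 'I_m.+1 -> 'rV[R]_N) :
  gram p = gram (fun j => p (widen_ord (leqnSn m) j))
           + (p ord_max)^T *m p ord_max.
Proof. by rewrite /gram big_ord_recr addrA. Qed.

Lemma det_gram_gt0 m (p : 'I_m -> 'rV[R]_N) : 0 < \det (gram p).
Proof.
elim: m p => [|m IH] p.
  by rewrite /gram big_ord0 addr0 det_scalar exprn_gt0.
have co := gram_coercive (fun j => p (widen_ord (leqnSn m) j)).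
rewrite gram_recr det_rank1D ?(coercive_unitmx lam_gt0 co) //.
by rewrite mulr_gt0 ?IH // ltr_wpDr ?ltr01 ?(qform_invmx_ge0 lam_gt0 co).
Qed.

Lemma det_gram_le m (p : 'I_m -> 'rV[R]_N) (M : R) :
  (forall j, qform 1%:M (p j) <= M) ->
  \det (gram p) <= lam ^+ N * (1 + M / lam) ^+ m.
Proof.
elim: m p => [|m IH] p pM.
  by rewrite /gram big_ord0 addr0 det_scalar mulr1.
have co := gram_coercive (fun j => p (widen_ord (leqnSn m) j)).
rewrite gram_recr det_rank1D ?(coercive_unitmx lam_gt0 co) // exprSr mulrA.
apply: ler_pM.
- by rewrite ltW ?det_gram_gt0.
- by rewrite addr_ge0 ?ler01 ?(qform_invmx_ge0 lam_gt0 co).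
- by apply: IH => j; apply: pM.
by rewrite lerD2l (le_trans (qform_invmx_le lam_gt0 co _)) // ler_pM2r ?invr_gt0.
Qed.

Lemma exchange_gram m (p : 'I_m -> 'rV[R]_N) v i :
  gram (fun j => if j == i then v else p j) =
  gram p + v^T *m v - (p i)^T *m p i.
Proof.
rewrite /gram (bigD1 i) //= eqxx [in RHS](bigD1 i) //=.
under eq_bigr => j /negPf ji do rewrite ji.
rewrite -!addrA; congr (_ + _).
by rewrite [RHS]addrCA [_ + (v^T *m v - _)]addrCA subrr addr0 addrC.
Qed.

(** The leverages [p H^-1 p^T] sum to the trace of [H^-1 (H - lam I)]. *)
Lemma sum_leverage_le m (p : 'I_m -> 'rV[R]_N) v :
  let H := gram p + v^T *m v in
  \sum_i qform (invmx H) (p i) + qform (invmx H) v <= N%:R.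
Proof.
set H := gram p + _ => /=.
(* H is itself the Gram matrix of the m + 1 vectors p_0, ..., p_(m-1), v. *)
have HE : H = gram (fun j : 'I_m.+1 => odflt v (omap p (unlift ord_max j))).
  rewrite gram_recr unlift_none /=; congr (_ + _); rewrite /H /gram.
  congr (_ + _); apply: eq_bigr => i _.
  have -> : widen_ord (leqnSn m) i = lift ord_max i.
    by apply: val_inj => /=; rewrite /bump leqNgt ltn_ord.
  by rewrite liftK.
have co : coercive lam H by rewrite HE; apply: gram_coercive.
have qE w : qform (invmx H) w = \tr (invmx H *m (w^T *m w)).
  by rewrite mulmxA mxtrace_mulC mulmxA /qform /mxtrace big_ord1.
rewrite qE (eq_bigr _ (fun i _ => qE (p i))) -raddf_sum -mulmx_sumr -raddfD.
rewrite -mulmxDr.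
have -> : \sum_i (p i)^T *m p i + v^T *m v = H - lam%:M.
  by rewrite /H /gram [RHS]addrAC [lam%:M + _]addrC addrK.
rewrite mulmxBr mulVmx ?(coercive_unitmx lam_gt0 co) // raddfB /= mxtrace1.
rewrite mul_mx_scalar mxtraceZ lerBlDr lerDl.
by rewrite mulr_ge0 ?(mxtrace_invmx_ge0 lam_gt0 co) // ltW.
Qed.

(** If no exchange of some [p_i] for [v] increases the determinant of the Gram
    matrix by more than the factor [(m + 1) / m], then [v] has small leverage. *)
Lemma near_max_leverage_le m (p : 'I_m -> 'rV[R]_N) v : (N < m)%N ->
  (forall i, m%:R * \det (gram (fun j => if j == i then v else p j))
             <= m.+1%:R * \det (gram p)) ->
  (m.+1%:R - N%:R) * qform (invmx (gram p)) v <= N.+1%:R.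
Proof.
move=> Nm maxp; set G := gram p; set H := G + v^T *m v.
pose h w := qform (invmx H) w; set l := qform _ v.
have coG : coercive lam G by apply: gram_coercive.
have l0 : 0 <= l by apply: (qform_invmx_ge0 lam_gt0 coG).
have G0 : 0 < \det G by apply: det_gram_gt0.
have HG : \det H = \det G * (1 + l).
  by rewrite det_rank1D ?(coercive_unitmx lam_gt0 coG).
have H0 : 0 < \det H by rewrite HG mulr_gt0 // ltr_wpDr.
have uH : H \in unitmx by rewrite unitmxE unitfE gt_eqF.
have GH : \det G = \det H * (1 - h v) by rewrite -det_rank1B // addrK.
(* Adding v to G, then removing it, gives two expressions of the ratio of
   det G and det H. *)
have hl : (1 - h v) * (1 + l) = 1.
  apply: (mulfI (lt0r_neq0 H0)).
  by rewrite mulrA -GH -HG mulr1.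
have le i : m%:R * (1 - h (p i)) <= m.+1%:R * (1 - h v).
  have := maxp i; rewrite exchange_gram -/G -/H det_rank1B // -/(h _).
  by rewrite GH mulrCA [X in _ <= X]mulrCA ler_pM2l.
have m0 : 0 < m%:R :> R by rewrite ltr0n (leq_ltn_trans _ Nm).
have : \sum_(i < m) (m%:R * (1 - h (p i))) <= m%:R * (m.+1%:R * (1 - h v)).
  apply: le_trans (ler_sum _ (fun i _ => le i)) _.
  by rewrite sumr_const card_ord -[X in X <= _]mulr_natl.
rewrite -mulr_sumr ler_pM2l // sumrB sumr_const card_ord.
have := sum_leverage_le p v; rewrite /= -/G -/H -/(h v) -natr1 -[N.+1%:R]natr1.
set S := \sum_i _; move=> S1 S2.
have : m%:R + 1 - N%:R <= (m%:R + 2) * (1 - h v) by lra.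
rewrite -(ler_pM2r (_ : 0 < 1 + l)); last by rewrite ltr_wpDr.
rewrite -mulrA hl; lra.
Qed.
End Gram.

(** * Sampling operators *)

(** Cauchy-Schwarz inequality against a constant vector. *)
Lemma sum_norm_le_sqrt (R : rcfType) m (u : 'I_m -> R) (L : R) :
  \sum_j u j ^+ 2 <= L -> \sum_j `|u j| <= Num.sqrt m%:R * Num.sqrt L.
Proof.
move=> uL; rewrite -sqrtrM ?ler0n //.
rewrite -[leLHS]ger0_norm ?sumr_ge0 // -sqrtr_sqr ler_wsqrtr //.
apply: le_trans (ler_wpM2l (ler0n _ m) uL).
have -> : m%:R * \sum_j u j ^+ 2
  = (\sum_(i < m) \sum_(j < m) (u i ^+ 2 + u j ^+ 2)) / 2.
  under [in RHS]eq_bigr => i _ do rewrite big_split sumr_const card_ord /=.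
  rewrite big_split /= sumr_const card_ord sumrMnl -[X in _ = (X + _) / _]mulr_natl.
  rewrite -[X in _ = (_ + X) / _]mulr_natl.
  by field.
rewrite ler_pdivlMr ?ltr0n // expr2 mulr_suml mulr_suml; apply: ler_sum => i _.
rewrite mulr_sumr mulr_suml; apply: ler_sum => j _.
rewrite -[u i ^+ 2]real_normK ?num_real // -[u j ^+ 2]real_normK ?num_real //.
have := sqr_ge0 (`|u i| - `|u j|); nra.
Qed.

Section Sampling.
Variables (R : realType) (X : Type) (A : set X).

(** The supremum of the determinants is positive and finite, so that some
    choice of nodes attains it up to the factor [(m + 1) / m]; no topology on
    [X] is needed. *)
Lemma near_max_gram N (phi : X -> 'rV[R]_N) (M lam : R) m :
  0 < lam -> A !=set0 -> (forall x, A x -> qform 1%:M (phi x) <= M) ->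
  (0 < m)%N ->
  exists xi : 'I_m -> X, (forall j, A (xi j)) /\
    forall z : 'I_m -> X, (forall j, A (z j)) ->
      m%:R * \det (gram lam (phi \o z)) <= m.+1%:R * \det (gram lam (phi \o xi)).
Proof.
move=> lam0 [x0 Ax0] phiM m0.
pose E := [set \det (gram lam (phi \o z)) | z in [set z : 'I_m -> X | forall j, A (z j)]].
have Eub : has_ubound E.
  exists (lam ^+ N * (1 + M / lam) ^+ m) => _ [z Az <-].
  by apply: det_gram_le => // j; apply: phiM.
have E0 : E !=set0 by exists (\det (gram lam (phi \o (fun _ : 'I_m => x0)))), (fun=> x0).
have supE0 : 0 < sup E.
  apply: lt_le_trans (det_gram_gt0 lam0 (phi \o (fun _ : 'I_m => x0))) _.
  by apply: ub_le_sup => //; exists (fun=> x0).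
have mR : 0 < m%:R :> R by rewrite ltr0n.
have eps0 : 0 < sup E / m.+1%:R by rewrite divr_gt0 ?ltr0n.
have [_ [xi Axi <-] lt] := sup_adherent eps0 (conj E0 Eub).
exists xi; split=> // z Az.
have zE : \det (gram lam (phi \o z)) <= sup E by apply: ub_le_sup => //; exists z.
apply: le_trans (ler_wpM2l (ltW mR) zE) _.
suff -> : m%:R * sup E = m.+1%:R * (sup E - sup E / m.+1%:R).
  by rewrite ler_pM2l ?ltr0n // ltW.
by rewrite mulrBr [_ * (_ / _)]mulrC divfK ?pnatr_eq0 // -[m.+1%:R]natr1; ring.
Qed.

(** The weight functions are linear combinations of the entries of [phi], with
    coefficients in the columns of [C]. *)
Lemma sampling_operator (b : R) N (phi : X -> 'rV[R]_N) (M eta : R) m :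
  1 < b <= 2 -> A !=set0 -> (forall x, A x -> qform 1%:M (phi x) <= M) ->
  (0 < m)%N -> b * N%:R <= m%:R - 1 -> 0 < eta ->
  exists (xi : 'I_m -> X) (C : 'M[R]_(N, m)), (forall j, A (xi j)) /\
    forall x, A x ->
      \sum_j `|(phi x *m C) 0 j| <= Num.sqrt m%:R * Num.sqrt (b - 1)^-1 /\
      forall k, `|phi x 0 k - \sum_j (phi x *m C) 0 j * phi (xi j) 0 k| <= eta.
Proof.
move=> /andP[b1 b2] A0 phiM m0 bN eta0.
have b10 : 0 < b - 1 by rewrite subr_gt0.
(* With this choice, lam / (b - 1) is the square of the tolerance eta. *)
pose lam := eta ^+ 2 * (b - 1).
have lam0 : 0 < lam by rewrite mulr_gt0 ?exprn_gt0.
have [xi [Axi xiP]] := near_max_gram lam0 A0 phiM m0.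
pose G := gram lam (phi \o xi).
have co : coercive lam G by apply: gram_coercive.
have N0 : 0 <= N%:R :> R by rewrite ler0n.
have Nm : (N < m)%N by rewrite -(ltr_nat R); nra.
exists xi, (invmx G *m \matrix_(k, j) phi (xi j) 0 k); split=> // x Ax.
set l := qform (invmx G) (phi x).
have lP : l <= (b - 1)^-1.
  have : (m.+1%:R - N%:R) * l <= N.+1%:R.
    apply: near_max_leverage_le => // i.
    have := xiP (fun j => if j == i then x else xi j).
    have -> : phi \o (fun j => if j == i then x else xi j) =
       fun j => if j == i then phi x else (phi \o xi) j.
      by apply/funext => j /=; case: ifP.
    by apply=> j; case: ifP.
  have l0 : 0 <= l by apply: (qform_invmx_ge0 lam0 co).
  rewrite -[_^-1]mul1r ler_pdivlMr // -[N.+1%:R]natr1 -[m.+1%:R]natr1 => lN.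
  have N1 : 0 < N%:R + 1 :> R by rewrite ltr_wpDl.
  rewrite -(ler_pM2r N1) mul1r; apply: le_trans lN.
  by rewrite -mulrA [leRHS]mulrC ler_wpM2l //; nra.
set w := phi x *m invmx G.
have uE j : (phi x *m (invmx G *m \matrix_(k, j) phi (xi j) 0 k)) 0 j
    = (w *m (phi (xi j))^T) 0 0.
  rewrite mulmxA -/w !mxE; apply: eq_bigr => k _.
  by rewrite !mxE.
split.
  apply: sum_norm_le_sqrt; apply: le_trans lP.
  rewrite /l (qform_invmx lam0 co) -/w qform_gram.
  under eq_bigr => j _ do rewrite uE.
  by rewrite lerDr mulr_ge0 ?qform1_ge0 // ltW.
move=> k; under eq_bigr => j _ do rewrite uE.
have -> : phi x 0 k - \sum_j (w *m (phi (xi j))^T) 0 0 * phi (xi j) 0 k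
   = lam * w 0 k.
  have /matrixP/(_ 0 k) : phi x = w *m G.
    by rewrite /w -mulmxA mulVmx ?mulmx1 // (coercive_unitmx lam0 co).
  rewrite /G /gram mulmxDr mul_mx_scalar mulmx_sumr !mxE summxE => ->.
  rewrite -addrA [X in _ + X](_ : _ = 0) ?addr0 //.
  apply/eqP; rewrite subr_eq0; apply/eqP/eq_bigr => j _.
  by rewrite mulmxA [LHS]mxE big_ord1.
rewrite -[leLHS]ger0_norm // -[eta]gtr0_norm // -ler_sqr ?nnegrE //.
rewrite !real_normK ?num_real // (le_trans (mulmx_invmx_le lam0 co _ _)) //.
rewrite -/l (le_trans (ler_wpM2l (ltW lam0) lP)) //.
by rewrite /lam mulfK ?gt_eqF.
Qed.
End Sampling.

(** * Scalar fields with a real-valued modulus *)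

(** [F] is a field containing the reals through [iota], and [abs] is its norm
    seen as a real number. *)
Section ScalarField.
Variables (R : realType) (F : numFieldType) (abs : F -> R).
Variable iota : {rmorphism R -> F}.
Hypothesis iota_le : {mono iota : x y / x <= y}.
Hypothesis absE : forall z, iota (abs z) = `|z|.

Lemma abs_ge0 z : 0 <= abs z.
Proof. by rewrite -iota_le rmorph0 absE normr_ge0. Qed.

Lemma abs0 : abs 0 = 0.
Proof. by apply/(fmorph_inj iota); rewrite absE normr0 rmorph0. Qed.

Lemma abs_triangle z w : abs (z + w) <= abs z + abs w.
Proof. by rewrite -iota_le rmorphD !absE ler_normD. Qed.

Lemma absN z : abs (- z) = abs z.
Proof. by apply/(fmorph_inj iota); rewrite !absE normrN. Qed.

Lemma absM z w : abs (z * w) = abs z * abs w.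
Proof. by apply/(fmorph_inj iota); rewrite rmorphM !absE normrM. Qed.

Lemma abs_iota r : abs (iota r) = `|r|.
Proof.
have [r0|/ltW r0] := leP 0 r.
  rewrite ger0_norm //; apply/(fmorph_inj iota).
  by rewrite absE ger0_norm // -[0](rmorph0 iota) iota_le.
rewrite ler0_norm //; apply/(fmorph_inj iota).
by rewrite absE ler0_norm ?rmorphN // -[0](rmorph0 iota) iota_le.
Qed.

Lemma abs_sum (I : Type) (s : seq I) (f : I -> F) :
  abs (\sum_(i <- s) f i) <= \sum_(i <- s) abs (f i).
Proof.
elim/big_ind2: _ => [|x1 x2 y1 y2 h1 h2|i _]; first by rewrite abs0.
- by apply: le_trans (abs_triangle _ _) _; apply: lerD.
- by [].
Qed.

Lemma abs_lipschitz z w : `|abs z - abs w| <= abs (z - w).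
Proof.
have := abs_triangle (z - w) w; have := abs_triangle (w - z) z.
rewrite !subrK -(absN (w - z)) opprB => h1 h2.
by rewrite ler_norml; lra.
Qed.

Lemma lipschitz_continuous (f : F -> R) :
  (forall z w, `|f z - f w| <= abs (z - w)) -> continuous f.
Proof.
move=> fL x; apply/(@cvgrPdist_lt _ _ _ _ (nbhs_filter x)) => e e0.
have ie0 : 0 < iota e by rewrite -[0](rmorph0 iota) (leW_mono iota_le).
have := nbhsx_ballx x (iota e) ie0; apply: filterS => t.
rewrite -ball_normE /= -absE (leW_mono iota_le).
exact: le_lt_trans (fL _ _).
Qed.

Lemma iota_continuous : continuous iota.
Proof.
move=> x; apply/cvgrPdist_lt => e e0.
have eE : iota (abs e) = e by rewrite absE gtr0_norm.
have ae0 : 0 < abs e by rewrite -(leW_mono iota_le) rmorph0 eE.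
have := nbhsx_ballx x (abs e) ae0; apply: filterS => t.
by rewrite -ball_normE /= -rmorphB -absE abs_iota -{2}eE (leW_mono iota_le).
Qed.

Lemma within_continuous_post (T U V : topologicalType) (A : set T)
  (f : T -> U) (g : U -> V) :
  {within A, continuous f} -> continuous g -> {within A, continuous (g \o f)}.
Proof.
move=> cf cg x; apply: (@continuous_comp (subspace A) U V); first exact: cf.
exact: cg.
Qed.

Lemma within_continuous_bounded (T : topologicalType) (A : set T) (f : T -> R) :
  compact A -> {within A, continuous f} ->
  exists M, forall t, A t -> `|f t| <= M.
Proof.
move=> cA cf; have := continuous_compact cf cA.
move/compact_bounded => [M [_ MP]]; exists (M + 1) => t At.
by apply: (MP (M + 1)); [rewrite ltrDl|exists t].
Qed.

Lemma abs_bounded (T : topologicalType) (A : set T) (f : T -> F) :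
  compact A -> {within A, continuous f} ->
  exists M, forall t, A t -> abs (f t) <= M.
Proof.
move=> cA cf.
have cabs := within_continuous_post cf (lipschitz_continuous abs_lipschitz).
have [M MP] := within_continuous_bounded cA cabs.
by exists M => t /MP; rewrite ger0_norm // abs_ge0.
Qed.

Lemma unif_norm_ge0 (T : Type) (A : set T) (f : T -> F) : 0 <= unif_norm abs A f.
Proof.
rewrite /unif_norm; set E := (X in sup X).
have [[[e Ee] Eub]|/sup_out ->] := pselect (has_sup E); last by [].
apply: le_trans (ub_le_sup Eub Ee).
by case: Ee => t _ <-; apply: abs_ge0.
Qed.

Lemma unif_norm_le (T : Type) (A : set T) (f : T -> F) M :
  0 <= M -> (forall t, A t -> abs (f t) <= M) -> unif_norm abs A f <= M.
Proof.
move=> M0 fM; have [->|/set0P A0] := eqVneq A set0.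
  by rewrite /unif_norm image_set0 sup0.
apply: ge_sup; first by case: A0 => t At; exists (abs (f t)), t.
by move=> _ [t At <-]; apply: fM.
Qed.

Lemma le_unif_norm (T : Type) (A : set T) (f : T -> F) M t :
  (forall t, A t -> abs (f t) <= M) -> A t -> abs (f t) <= unif_norm abs A f.
Proof.
move=> fM At; apply: ub_le_sup; last by exists t.
by exists M => _ [s As <-]; apply: fM.
Qed.

Lemma best_approx_le (T : Type) (A : set T) (D : set (T -> F)) m f
    (g : 'I_m -> T -> F) : (forall i, D (g i)) ->
  best_approx abs A D m f <= unif_norm abs A (fun t => f t - \sum_i g i t).
Proof.
move=> Dg; apply: ge_inf.
  by exists 0 => _ [c [h [_ ->]]]; apply: unif_norm_ge0.
exists (fun=> 1), g; split=> //; congr (unif_norm _ _ _).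
by apply/funext => t; congr (_ - _); apply: eq_bigr => i _; rewrite mul1r.
Qed.

(** Every uniform norm over the empty set is 0, and so is the infimum of the
    empty set, which occurs if [D] is empty and [0 < m]. *)
Lemma best_approx_set0 (T : Type) (D : set (T -> F)) m f :
  best_approx abs set0 D m f = 0.
Proof.
rewrite /best_approx; set E := (X in inf X).
have [->|/set0P E0] := eqVneq E set0; first by rewrite inf0.
have EE : E = [set 0].
  apply/seteqP; split=> [_ [c [g [_ ->]]]|].
    by rewrite /unif_norm image_set0 sup0.
  case: E0 => e [c [g [Dg _]]] _ ->; exists c, g; split=> //.
  by rewrite /unif_norm image_set0 sup0.
by rewrite EE inf1.
Qed.

Lemma within_continuous_lincomb (T : topologicalType) (A : set T) n
    (f : 'I_n -> T -> R) (a : 'I_n -> R) :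
  (forall i, {within A, continuous (f i)}) ->
  {within A, continuous (fun t => \sum_i f i t * a i)}.
Proof.
move=> cf; apply: (@continuous_big _ _ _ _ _ _ (subspace A)) => [|i _ x].
  exact: add_continuous.
by apply: cvgM; [exact: cf|exact: cvg_cst].
Qed.

(** * From bilinear to adaptive approximation *)

(** [F] has real dimension at most [d]: every [z] is a combination of the fixed
    scalars [c k] with coefficients [part k z], which are 1-Lipschitz real
    functions of [z]. *)
Variables (b : R) (d : nat) (c : 'I_d -> F) (part : 'I_d -> F -> R).
Hypothesis b12 : 1 < b <= 2.
Hypothesis d_gt0 : (0 < d)%N.
Hypothesis part_lipschitz : forall k z w, `|part k z - part k w| <= abs (z - w).
Hypothesis partE : forall z, z = \sum_k c k * iota (part k z).

(** Error at [(x, y)] of the sampling operator with nodes [xi] and real weights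
    [U], for a kernel within [e] of a bilinear form at [x] and at the nodes.
    The first term is the defect of reproduction of the [u i]. *)
Lemma sampling_error (X Y : Type) n m (u : 'I_n -> X -> F) (v : 'I_n -> Y -> F)
    (K : X * Y -> F) (U : 'I_m -> R) (xi : 'I_m -> X) (eta e L : R) (x : X)
    (y : Y) (V : 'I_n -> R) :
  0 <= e -> 0 <= L ->
  (forall i, abs (v i y) <= V i) ->
  \sum_j `|U j| <= L ->
  (forall i k, `|part k (u i x) - \sum_j U j * part k (u i (xi j))| <= eta) ->
  (forall z, z = x \/ (exists j, z = xi j) ->
     abs (K (z, y) - \sum_i u i z * v i y) <= e) ->
  abs (K (x, y) - \sum_j iota (U j) * K (xi j, y))
    <= eta * (\sum_i \sum_k V i * abs (c k)) + (1 + L) * e.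
Proof.
move=> e0 L0 vV UL Ueta Ke.
pose E z := K (z, y) - \sum_i u i z * v i y.
have EK z : K (z, y) = \sum_i u i z * v i y + E z by rewrite addrC subrK.
have key : K (x, y) - \sum_j iota (U j) * K (xi j, y) =
  \sum_i \sum_k v i y * c k *
     iota (part k (u i x) - \sum_j U j * part k (u i (xi j)))
  + (E x - \sum_j iota (U j) * E (xi j)).
  rewrite EK; under [X in _ - X]eq_bigr => j _ do rewrite EK mulrDr.
  rewrite big_split /= opprD addrACA; congr (_ + _).
  under [X in _ - X]eq_bigr => j _ do rewrite mulr_sumr.
  rewrite exchange_big /= -sumrB; apply: eq_bigr => i _.
  rewrite {1}[u i x]partE.
  under [X in _ - X]eq_bigr => j _ do rewrite {1}[u i (xi j)]partE.
  under [X in _ = X]eq_bigr => k _ do rewrite rmorphB rmorph_sum /= mulrBr.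
  rewrite sumrB mulr_suml; congr (_ - _).
    by apply: eq_bigr => k _; ring.
  under [X in _ = X]eq_bigr => k _ do rewrite mulr_sumr.
  rewrite [RHS]exchange_big /=; apply: eq_bigr => j _.
  rewrite mulr_suml mulr_sumr; apply: eq_bigr => k _.
  by rewrite rmorphM; ring.
rewrite key; apply: le_trans (abs_triangle _ _) _; apply: lerD.
  apply: le_trans (abs_sum _ _) _; rewrite mulr_sumr; apply: ler_sum => i _.
  apply: le_trans (abs_sum _ _) _; rewrite mulr_sumr; apply: ler_sum => k _.
  rewrite !absM abs_iota mulrC; apply: ler_pM; rewrite ?mulr_ge0 ?abs_ge0 //.
  by apply: ler_wpM2r; rewrite ?abs_ge0.
apply: le_trans (abs_triangle _ _) _; rewrite absN mulrDl mul1r; apply: lerD.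
  by apply: Ke; left.
apply: le_trans (abs_sum _ _) _; apply: le_trans (ler_wpM2r e0 UL).
rewrite mulr_suml; apply: ler_sum => j _.
rewrite absM abs_iota ler_wpM2l //.
by apply: Ke; right; exists j.
Qed.

(** Common form of the real ([d = 1]) and complex ([d = 2]) inequalities. *)
Lemma adaptive_le_bilinear (X Y : topologicalType) (Omega1 : set X)
    (Omega2 : set Y) (K : X * Y -> F) m :
  compact Omega1 -> compact Omega2 ->
  {within Omega1 `*` Omega2, continuous K} -> (1 <= m)%N ->
  best_approx abs (Omega1 `*` Omega2) (adaptive_dict Omega1 K) m K
    <= (1 + Num.sqrt (b - 1)^-1) * Num.sqrt m%:R *
       best_approx_real abs (Omega1 `*` Omega2) (bilinear_dict Omega1 Omega2)
         ((d%:R * b)^-1 * (m%:R - 1)) K.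
Proof.
move=> c1 c2 cK m1.
have /andP[b1 b2] := b12.
have db0 : 0 < d%:R * b by rewrite mulr_gt0 ?ltr0n // (lt_trans ltr01).
set n := Num.truncn ((d%:R * b)^-1 * (m%:R - 1)).
have nle : b * (n * d)%:R <= m%:R - 1.
  have : n%:R <= (d%:R * b)^-1 * (m%:R - 1).
    by rewrite truncn_le mulr_ge0 ?invr_ge0 ?(ltW db0) // subr_ge0 ler1n.
  rewrite ler_pdivlMl // natrM.
  by have -> : b * (n%:R * d%:R) = d%:R * b * n%:R by ring.
set s := Num.sqrt _; set q := Num.sqrt m%:R.
have s0 : 0 <= s by apply: sqrtr_ge0.
have q1 : 1 <= q by rewrite -[1]sqrtr1 ler_wsqrtr // ler1n.
have Bs0 : 0 < (1 + s) * q by rewrite mulr_gt0 //; lra.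
rewrite -ler_pdivrMl // /best_approx_real -/n; apply: lb_le_inf.
  exists (unif_norm abs (Omega1 `*` Omega2)
    (fun t => K t - \sum_(i < n) 1 * (fun p : X * Y => 0 * 0) t)).
  exists (fun=> 1), (fun _ p => 0 * 0); split=> // i.
  by exists (fun=> 0), (fun=> 0); split=> //; apply: continuous_subspaceT => ?;
     apply: cst_continuous.
move=> e [a [g [Dg eE]]]; rewrite ler_pdivrMl //.
have e0 : 0 <= e by rewrite eE unif_norm_ge0.
have [empty|/set0P[[x0 y0] [/= O1 O2]]] := eqVneq (Omega1 `*` Omega2) set0.
  by rewrite empty best_approx_set0 mulr_ge0 // ltW.
have [u /choice[v uP]] := choice Dg.
have cu i : {within Omega1, continuous (u i)} by case: (uP i).
have cv i : {within Omega2, continuous (v i)} by case: (uP i).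
have gE i : g i = (fun p => u i p.1 * v i p.2) by case: (uP i).
have [MK MKP] := abs_bounded (compact_setX c1 c2) cK.
have [Mu MuP] := choice (fun i => abs_bounded c1 (cu i)).
have [Mv MvP] := choice (fun i => abs_bounded c2 (cv i)).
(* The supremum is that of a bounded set, hence e bounds the error pointwise. *)
have eP x y : Omega1 x -> Omega2 y ->
    abs (K (x, y) - \sum_i u i x * (a i * v i y)) <= e.
  move=> Ox Oy; pose M := MK + \sum_i abs (a i) * (Mu i * Mv i).
  have -> : \sum_i u i x * (a i * v i y) = \sum_i a i * g i (x, y).
    by apply: eq_bigr => i _; rewrite gE mulrCA.
  pose f t := K t - \sum_i a i * g i t.
  rewrite eE -/(f (x, y)); apply: (@le_unif_norm _ _ f M) => //.
  move=> [x' y'] [/= Ox' Oy'].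
  apply: le_trans (abs_triangle _ _) _; rewrite absN; apply: lerD.
    exact: MKP.
  apply: le_trans (abs_sum _ _) _; apply: ler_sum => i _.
  rewrite gE !absM ler_wpM2l ?abs_ge0 //.
  by apply: ler_pM; rewrite ?abs_ge0 ?MuP ?MvP.
pose phi x : 'rV[R]_(n * d) := mxvec (\matrix_(i, k) part k (u i x)).
have cphi l : {within Omega1, continuous (fun x => phi x 0 l)}.
  case/mxvec_indexP: l => i k.
  rewrite (_ : (fun x => _) = part k \o u i); last first.
    by apply/funext => x; rewrite mxvecE mxE.
  exact: within_continuous_post (cu i) (lipschitz_continuous (@part_lipschitz k)).
have [Mphi MphiP] := choice (fun l => within_continuous_bounded c1 (cphi l)).
(* W bounds the amplification of the defect of reproduction of the u_i. *)
pose W := \sum_i \sum_k (abs (a i) * Mv i) * abs (c k).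
have W0 : 0 <= W.
  rewrite sumr_ge0 // => i _; rewrite sumr_ge0 // => k _.
  by rewrite !mulr_ge0 ?abs_ge0 // (le_trans (abs_ge0 (v i y0))) ?MvP.
apply/ler_addgt0Pr => eps eps0.
have W1 : 0 < 1 + W by rewrite ltr_wpDr.
have eta0 : 0 < eps / (1 + W) by rewrite divr_gt0.
have phiM x : Omega1 x -> qform 1%:M (phi x) <= \sum_l Mphi l ^+ 2.
  move=> Ox; rewrite qform1E; apply: ler_sum => l _.
  rewrite -real_normK ?num_real // ler_sqr ?nnegrE ?(MphiP l) //.
  by rewrite (le_trans _ (MphiP l _ Ox)).
have [xi [C [Oxi xiP]]] :=
  sampling_operator b12 (ex_intro _ x0 O1) phiM m1 nle eta0.
pose U j x := iota ((phi x *m C) 0 j).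
have DU j : adaptive_dict Omega1 K (fun p => U j p.1 * K (xi j, p.2)).
  exists (xi j), (U j); split=> //.
  apply: (within_continuous_post _ iota_continuous).
  under eq_fun => x do rewrite mxE.
  exact: within_continuous_lincomb.
apply: le_trans (best_approx_le _ _ DU) _.
apply: unif_norm_le => [|[x y] [/= Ox Oy]].
  by rewrite addr_ge0 ?(ltW eps0) // mulr_ge0 // ltW.
have [UL Ueta] := xiP x Ox.
apply: le_trans (@sampling_error _ _ _ _ u (fun i y => a i * v i y) K
  (fun j => (phi x *m C) 0 j) xi _ _ _ x y (fun i => abs (a i) * Mv i)
  e0 _ _ UL _ _) _.
- by rewrite mulr_ge0 ?sqrtr_ge0.
- by move=> i; rewrite absM ler_wpM2l ?abs_ge0 ?MvP.
- move=> i k; have := Ueta (mxvec_index i k).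
  rewrite mxvecE mxE.
  under eq_bigr => j _ do rewrite mxvecE mxE.
  exact.
- by move=> z [->|[j ->]]; apply: eP.
rewrite -/W -/q -/s addrC; apply: lerD.
  by rewrite ler_wpM2r // mulrDl mul1r mulrC lerD2r.
rewrite mulrAC ler_pdivrMr // ler_wpM2l ?ltW //; lra.
Qed.

End ScalarField.

(** * Real and complex kernels *)

Section RealAndComplex.
Variable R : realType.

Lemma adaptive_le_bilinear_real (b : R) (X Y : topologicalType)
    (Omega1 : set X) (Omega2 : set Y) (K : X * Y -> R) m :
  1 < b <= 2 -> compact Omega1 -> compact Omega2 ->
  {within Omega1 `*` Omega2, continuous K} -> (1 <= m)%N ->
  best_approx (@abs_real R) (Omega1 `*` Omega2) (adaptive_dict Omega1 K) m K
    <= (1 + Num.sqrt (b - 1)^-1) * Num.sqrt m%:R *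
       best_approx_real (@abs_real R) (Omega1 `*` Omega2)
         (bilinear_dict Omega1 Omega2) (b^-1 * (m%:R - 1)) K.
Proof.
move=> b12 c1 c2 cK m1.
have -> : b^-1 = (1%:R * b)^-1 by rewrite mul1r.
apply: (@adaptive_le_bilinear R R (@abs_real R) idfun _ _ b 1
  (fun=> 1) (fun=> id)) => //.
by move=> z; rewrite big_ord1 mul1r.
Qed.

Lemma adaptive_le_bilinear_complex (b : R) (X Y : topologicalType)
    (Omega1 : set X) (Omega2 : set Y) (K : X * Y -> complex_numField R) m :
  1 < b <= 2 -> compact Omega1 -> compact Omega2 ->
  {within Omega1 `*` Omega2, continuous K} -> (1 <= m)%N ->
  best_approx (@abs_complex R) (Omega1 `*` Omega2) (adaptive_dict Omega1 K) m K
    <= (1 + Num.sqrt (b - 1)^-1) * Num.sqrt m%:R *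
       best_approx_real (@abs_complex R) (Omega1 `*` Omega2)
         (bilinear_dict Omega1 Omega2) ((2 * b)^-1 * (m%:R - 1)) K.
Proof.
move=> b12 c1 c2 cK m1.
pose iota : {rmorphism R -> complex_numField R} := real_complex R.
have absE (z : complex_numField R) : iota (abs_complex z) = `|z|.
  by rewrite /abs_complex normc_def.
have Re_le (z : complex_numField R) : `|complex.Re z| <= abs_complex z.
  rewrite /abs_complex normc_def /= -sqrtr_sqr ler_wsqrtr // lerDl sqr_ge0 //.
have Im_le (z : complex_numField R) : `|complex.Im z| <= abs_complex z.
  by rewrite /abs_complex normc_def /= -sqrtr_sqr ler_wsqrtr // lerDr sqr_ge0.
apply: (@adaptive_le_bilinear R _ (@abs_complex R) iota _ _ b 2
  (fun k => if k == ord0 then 1 else 'i%C)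
  (fun k z => if k == ord0 then complex.Re z else complex.Im z)) => //.
- by move=> x y; rewrite lecR.
- move=> k z w; case: (k == ord0).
    by have := Re_le (z - w); case: z w => [? ?] [? ?].
  by have := Im_le (z - w); case: z w => [? ?] [? ?].
- move=> z; rewrite big_ord_recl big_ord1 /= mul1r; exact: complexE.
Qed.

End RealAndComplex.

Theorem theorem6p1 (R : realType) (b : R) (hb : 1 < b <= 2) :
  exists B : R, 0 < B /\
    forall (d1 d2 : nat) (Omega1 : set 'rV[R]_d1) (Omega2 : set 'rV[R]_d2),
      compact Omega1 -> compact Omega2 ->
      (forall K : 'rV[R]_d1 * 'rV[R]_d2 -> R,
         {within Omega1 `*` Omega2, continuous K} ->
         forall m : nat, (1 <= m)%N ->
         best_approx (@abs_real R) (Omega1 `*` Omega2)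
             (adaptive_dict Omega1 K) m K
           <= B * Num.sqrt m%:R *
              best_approx_real (@abs_real R) (Omega1 `*` Omega2)
                (bilinear_dict Omega1 Omega2) (b^-1 * (m%:R - 1)) K)
      /\
      (forall K : 'rV[R]_d1 * 'rV[R]_d2 -> complex_numField R,
         {within Omega1 `*` Omega2, continuous K} ->
         forall m : nat, (1 <= m)%N ->
         best_approx (@abs_complex R) (Omega1 `*` Omega2)
             (adaptive_dict Omega1 K) m K
           <= B * Num.sqrt m%:R *
              best_approx_real (@abs_complex R) (Omega1 `*` Omega2)
                (bilinear_dict Omega1 Omega2)
                ((2 * b)^-1 * (m%:R - 1)) K).
Proof.
exists (1 + Num.sqrt (b - 1)^-1); split.
  by rewrite ltr_wpDr // sqrtr_ge0.
move=> d1 d2 Omega1 Omega2 c1 c2; split=> K cK m m1.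
  exact: adaptive_le_bilinear_real.
exact: adaptive_le_bilinear_complex.
Qed.
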